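(* Let $n\ge1$ be an integer and $d\in\mathbb{Z}_{\ge0}$. Then $$\det(M_d)=\det(M_d')\prod_{s=0}^{2n-2}\left(x-\frac{s}{2}\right)^{f(d,s)},$$ where $$f(d,s)=\left|\{(\nu,\nu')\in\Lambda_{d,n}^*\times\Lambda_{d,n}^*:\ |\nu|=|\nu'|,\ \ell_{\nu'}<\ell_\nu,\ \ell_\nu+\ell_{\nu'}-1=s\}\right|.$$
   Context: $\mathbb{P}=\{(\nu_1,\nu_2)\in\mathbb{Z}_{\ge0}^2:\nu_1\ge\nu_2\}$ and $|\nu|=\nu_1+\nu_2$. Set $\Lambda_{d,n}=\{\mu\in\mathbb{P}:|\mu|\le d,\ \mu_2\le n\}$ and $\Lambda_{d,n}^*=\{\nu\in\mathbb{P}:|\nu|\le d,\ \nu_2\ge\lfloor|\nu|/2\rfloor-n\}$; these sets have the same cardinality. Total orders: for $\mu,\mu'\in\Lambda_{d,n}$, $\mu\preceq\mu'$ iff $\mu_2<\mu_2'$ or ($\mu_2=\mu_2'$ and $\mu_1\le\mu_1'$). For $\nu,\nu'\in\Lambda_{d,n}^*$, $\nu\leqslant\nu'$ iff $\lfloor\frac{\nu_1-\nu_2}2\rfloor<\lfloor\frac{\nu'_1-\nu'_2}2\rfloor$ or (these are equal and $|\nu|\le|\nu'|$). For $\nu\in\Lambda_{d,n}^*$, $\ell_\nu=\min(\nu_1-\nu_2,\ 2n+1-(\nu_1-\nu_2))$. For $\mu\in\Lambda_{d,n}$, $\nu\in\Lambda_{d,n}^*$ set $\lambda_{\mu,\nu}(x)=((2x+1)\ell_\nu-\ell_\nu^2)^{\mu_2}(\nu_1+\nu_2)^{\mu_1-\mu_2}\in\mathbb{Z}[x]$,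 with $0^0=1$. The square matrices $M_d$ and $M_d'$ have rows indexed by $\mu\in\Lambda_{d,n}$ and columns indexed by $\nu\in\Lambda_{d,n}^*$ (rows in increasing order with respect to $\preceq$, columns in increasing order with respect to $\leqslant$) and entries $\lambda_{\mu,\nu}(x)$ and $(2\ell_\nu)^{\mu_2}(\nu_1+\nu_2)^{\mu_1-\mu_2}$, respectively. *)

(* Defs.v *)
From mathcomp Require Import all_boot all_order all_algebra.
From mathcomp Require Import zify.

Set Implicit Arguments.
Unset Strict Implicit.
Unset Printing Implicit Defensive.

Import GRing.Theory.
Local Open Scope nat_scope.

(* Pairs (nu_1, nu_2) of naturals bounded by d: since |nu| <= d forces
   nu_1, nu_2 <= d, this finite type contains all of the index sets below
   (see LambdaP and LambdaStarP). *)
Notation npair d := ('I_d.+1 * 'I_d.+1)%type.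

Definition weight d (nu : npair d) : nat := nu.1 + nu.2.

Definition in_P d (nu : npair d) : bool := nu.2 <= nu.1.

Definition Lambda d n : {set npair d} :=
  [set mu | [&& in_P mu, weight mu <= d & mu.2 <= n]].

(* The truncated subtraction is harmless, as nu_2 >= 0. *)
Definition LambdaStar d n : {set npair d} :=
  [set nu | [&& in_P nu, weight nu <= d & (weight nu)./2 - n <= nu.2]].

Definition Lambda_le d (mu mu' : npair d) : bool :=
  (mu.2 < mu'.2) || ((mu.2 == mu'.2 :> nat) && (mu.1 <= mu'.1)).

Definition LambdaStar_le d (nu nu' : npair d) : bool :=
  ((nu.1 - nu.2)./2 < (nu'.1 - nu'.2)./2)
  || (((nu.1 - nu.2)./2 == (nu'.1 - nu'.2)./2) && (weight nu <= weight nu')).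

(* On LambdaStar d n one has nu_2 <= nu_1 and nu_1 - nu_2 <= 2n+1, so that
   neither subtraction is truncated (see LambdaStar_diff). *)
Definition ell d n (nu : npair d) : nat :=
  minn (nu.1 - nu.2) (2 * n + 1 - (nu.1 - nu.2)).

Lemma LambdaP d n (a b : nat) :
  (exists2 mu : npair d, mu \in Lambda d n & (mu.1 : nat, mu.2 : nat) = (a, b))
  <-> [/\ b <= a, a + b <= d & b <= n].
Proof.
split=> [[mu + [<- <-]]|[ba abd bn]].
  by rewrite inE /in_P /weight => /and3P[].
have ad : a < d.+1 by lia.
have bd : b < d.+1 by lia.
by exists (Ordinal ad, Ordinal bd) => //; rewrite inE /in_P /weight /= ba abd.
Qed.

Lemma LambdaStarP d n (a b : nat) :
  (exists2 nu : npair d,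
     nu \in LambdaStar d n & (nu.1 : nat, nu.2 : nat) = (a, b))
  <-> [/\ b <= a, a + b <= d & (a + b)./2 - n <= b].
Proof.
split=> [[nu + [<- <-]]|[ba abd abn]].
  by rewrite inE /in_P /weight => /and3P[].
have ad : a < d.+1 by lia.
have bd : b < d.+1 by lia.
by exists (Ordinal ad, Ordinal bd) => //; rewrite inE /in_P /weight /= ba abd.
Qed.

Lemma LambdaStar_diff d n (nu : npair d) :
  nu \in LambdaStar d n -> nu.2 <= nu.1 /\ nu.1 - nu.2 <= 2 * n + 1.
Proof. by case: nu => a b; rewrite inE /in_P /weight /= => /and3P[]; lia. Qed.

(* Both orders are total on the sets they sort, hence the enumerations
   below are the only increasing ones. *)
Lemma Lambda_le_order d :
  [/\ reflexive (@Lambda_le d), antisymmetric (@Lambda_le d),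
      transitive (@Lambda_le d) & total (@Lambda_le d)].
Proof.
rewrite /Lambda_le; split=> [[a b]|[a b] [a' b']|[a b] [a' b'] [a2 b2]|[a b] [a' b']] /=.
- lia.
- by move=> H; congr (_, _); apply: val_inj => /=; lia.
- lia.
- lia.
Qed.

Lemma LambdaStar_le_order d n :
  [/\ reflexive (@LambdaStar_le d),
      {in LambdaStar d n &, antisymmetric (@LambdaStar_le d)},
      transitive (@LambdaStar_le d) & total (@LambdaStar_le d)].
Proof.
rewrite /LambdaStar_le /weight.
split=> [[a b]|[a b] [a' b']|[a b] [a' b'] [a2 b2]|[a b] [a' b']] /=.
- lia.
- rewrite !inE /in_P /weight /= => H1 H2 H.
  by congr (_, _); apply: val_inj => /=; lia.
- lia.
- lia.
Qed.

(* (mu_1, mu_2) |-> (|mu| - k, k) with k = floor(|mu|/2) - mu_2 is an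
   involution of P exchanging Lambda d n and LambdaStar d n. *)
Definition npair_dual d (mu : npair d) : npair d :=
  let k := (weight mu)./2 - mu.2 in (inord (weight mu - k), inord k).

Lemma npair_dualE d (mu : npair d) :
  in_P mu -> weight mu <= d ->
  let k := (weight mu)./2 - mu.2 in
  (npair_dual mu).1 = weight mu - k :> nat /\ (npair_dual mu).2 = k :> nat.
Proof.
by case: mu => a b; rewrite /in_P /weight /= => h1 h2; split; rewrite inordK //;
  rewrite /weight /=; lia.
Qed.

Lemma npair_dual_P d (mu : npair d) :
  in_P mu -> weight mu <= d ->
  in_P (npair_dual mu) /\ weight (npair_dual mu) = weight mu.
Proof.
move=> h1 h2; have [] := npair_dualE h1 h2; move: h1 h2.
case: mu (npair_dual mu) => a b [a' b']; rewrite /in_P /weight /=; lia.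
Qed.

Lemma npair_dualK d (mu : npair d) :
  in_P mu -> weight mu <= d ->
  npair_dual (npair_dual mu) = mu.
Proof.
move=> h1 h2; have [h1' ew] := npair_dual_P h1 h2.
have h2' : weight (npair_dual mu) <= d by rewrite ew.
have [] := npair_dualE h1' h2'; have [] := npair_dualE h1 h2.
move: {h1' h2'} h1 h2 ew; move: (npair_dual (npair_dual mu)) (npair_dual mu).
case: mu => a b [a2 b2] [a1 b1]; rewrite /in_P /weight /=.
by move=> h1 h2 ew e1 e2 f1 f2; congr (_, _); apply: val_inj => /=; lia.
Qed.

Lemma card_LambdaStar d n : #|LambdaStar d n| = #|Lambda d n|.
Proof.
have aux (A B : {set npair d}) :
    (forall mu, mu \in A -> [/\ in_P mu, weight mu <= d & npair_dual mu \in B]) ->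
    #|A| <= #|B|.
  move=> H; rewrite -(@card_in_imset _ _ (@npair_dual d) A).
    by apply/subset_leq_card/subsetP => _ /imsetP[mu /H[_ _ ?] ->].
  move=> x y /H[x1 x2 _] /H[y1 y2 _] exy.
  by rewrite -(npair_dualK x1 x2) exy npair_dualK.
apply/eqP; rewrite eqn_leq; apply/andP; split; apply: aux => mu;
  rewrite !inE => /and3P[h1 h2 h3]; split=> //;
  have [h1' ew] := npair_dual_P h1 h2; rewrite h1' ew h2 /=;
  have [_ ->] := npair_dualE h1 h2; move: h1 h2 h3 {h1' ew};
  case: mu => a b; rewrite /in_P /weight /=; lia.
Qed.

Lemma size_sort_Lambda d n :
  size (sort (@Lambda_le d) (enum (Lambda d n))) == #|Lambda d n|.
Proof. by rewrite size_sort -cardE. Qed.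

Lemma size_sort_LambdaStar d n :
  size (sort (@LambdaStar_le d) (enum (LambdaStar d n))) == #|Lambda d n|.
Proof. by rewrite size_sort -cardE card_LambdaStar. Qed.

Definition row_index d n : #|Lambda d n|.-tuple (npair d) :=
  Tuple (size_sort_Lambda d n).

Definition col_index d n : #|Lambda d n|.-tuple (npair d) :=
  Tuple (size_sort_LambdaStar d n).

Local Open Scope ring_scope.

Definition lambda d n (mu nu : npair d) : {poly int} :=
  ((2%:R * 'X + 1) * (ell n nu)%:R - (ell n nu)%:R ^+ 2) ^+ mu.2
  * (nu.1 + nu.2)%N%:R ^+ (mu.1 - mu.2).

Definition lambda' d n (mu nu : npair d) : int :=
  (2%:R * (ell n nu)%:R) ^+ mu.2 * (nu.1 + nu.2)%N%:R ^+ (mu.1 - mu.2).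

Definition M d n : 'M[{poly int}]_#|Lambda d n| :=
  \matrix_(i, j) lambda n (tnth (row_index d n) i) (tnth (col_index d n) j).

Definition M' d n : 'M[int]_#|Lambda d n| :=
  \matrix_(i, j) lambda' n (tnth (row_index d n) i) (tnth (col_index d n) j).

(* ell nu' < ell nu makes ell nu positive, so that the subtraction of 1 is not
   truncated. *)
Definition f (n d s : nat) : nat :=
  #|[set p in setX (LambdaStar d n) (LambdaStar d n) |
      [&& weight p.1 == weight p.2, (ell n p.2 < ell n p.1)%N &
          ell n p.1 + ell n p.2 - 1 == s]%N]|.

(* Main.v *)
Require Import Defs.
From mathcomp Require Import all_boot all_order all_algebra.
From mathcomp Require Import zify ring.

(** Write y(l) = (2x+1)l - l^2.  Columns nu, nu' of M_d with the same weight
    become equal at every x with y(l_nu) = y(l_nu'), and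
      y(l) - y(l') = 2 (l - l') (x - (l + l' - 1)/2),
    so each pair of columns counted by f(d,s) should contribute one factor
    x - s/2 to the determinant, and for degree reasons nothing else can.

    Divisibility.  For a fixed s, the pairs (nu, nu') counted by f(d,s) are
    disjoint: l_nu determines l_nu' = s + 1 - l_nu, l is injective on the
    elements of Lambda* of a given weight, and 2 l_nu > s + 1 > 2 l_nu'
    separates first from second members.  The difference of two paired columns
    is divisible by x - s/2, so (x - s/2)^f(d,s) divides the determinant
    ([dvdp_det_columns], [dvdp_det_M]).  Over the rationals these powers are
    pairwise coprime for different s, hence their product divides it as well
    ([dvdp_prod_coprime]).

    Degree.  Row mu of M_d consists of polynomials of degree at most mu_2, whose
    coefficients of degree mu_2 form the row mu of M'_d.  Hence det M_d has
    degree at most D = sum of mu_2 over Lambda, and its coefficient of degree D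
    is det M'_d ([has_top_det], [has_top_lambda]).

    Counting.  The sum of f(d,s) over s is also D ([sum_f_second]).  It counts
    the pairs in Lambda* of equal weight with l_nu' < l_nu, that is half of the
    ordered pairs of distinct elements of equal weight, whatever strict order is
    used to choose the half; ordering by nu_2 instead of l makes the count
    explicit.

    So det M_d is a multiple of a monic polynomial of degree D, and comparing
    the coefficients of degree D identifies the cofactor ([has_top_dvdp]). *)

Set Implicit Arguments.
Unset Strict Implicit.
Unset Printing Implicit Defensive.

Import GRing.Theory.
Local Open Scope ring_scope.

(** * Coefficients at a prescribed degree bound *)

(** The leading coefficient relative to a degree bound k, which may be zero:
    unlike the true leading coefficient it is compatible with sums, products
    and therefore determinants without any nonvanishing condition. *)
Definition has_top (R : comNzRingType) (k : nat) (c : R) (p : {poly R}) :=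
  (size p <= k.+1)%N /\ p`_k = c.

Lemma has_topD (R : comNzRingType) k (c c' : R) p q :
  has_top k c p -> has_top k c' q -> has_top k (c + c') (p + q).
Proof.
move=> [sp <-] [sq <-]; split; last by rewrite coefD.
by rewrite (leq_trans (size_polyD _ _)) // geq_max sp.
Qed.

Lemma has_topM (R : comNzRingType) k k' (c c' : R) p q :
  has_top k c p -> has_top k' c' q -> has_top (k + k') (c * c') (p * q).
Proof.
move=> [sp <-] [sq <-]; split.
  by apply: (leq_trans (size_polyMleq _ _)); move: sp sq; lia.
have kk' : (k < (k + k').+1)%N by lia.
rewrite coefM (bigD1 (Ordinal kk')) //= addKn big1 ?addr0 // => i.
rewrite -val_eqE /= neq_ltn => /orP[ik|ki].
  by rewrite [q`_ _]nth_default ?mulr0 ?(leq_trans sq) //; lia.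
by rewrite nth_default ?mul0r ?(leq_trans sp).
Qed.

Lemma has_topX (R : comNzRingType) k (c : R) p m :
  has_top k c p -> has_top (k * m) (c ^+ m) (p ^+ m).
Proof.
move=> cp; elim: m => [|m IHm].
  by rewrite muln0 !expr0; split; rewrite ?size_poly1 ?coef1.
by rewrite mulnS !exprS; apply: has_topM.
Qed.

Lemma has_topC (R : comNzRingType) (c : R) : has_top 0 c c%:P.
Proof. by split; rewrite ?coefC // size_polyC leq_b1. Qed.

Lemma has_top_XsubC (R : comNzRingType) (a : R) : has_top 1 1 ('X - a%:P).
Proof. by split; rewrite ?size_XsubC // coefB coefX coefC subr0. Qed.

Lemma has_top_prod (R : comNzRingType) (I : Type) (t : seq I) (k : I -> nat)
    (c : I -> R) (p : I -> {poly R}) :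
  (forall i, has_top (k i) (c i) (p i)) ->
  has_top (\sum_(i <- t) k i) (\prod_(i <- t) c i) (\prod_(i <- t) p i).
Proof.
move=> topp; apply: (big_ind3 (fun k c p => @has_top R k c p)) => [||i _].
- exact: (has_topC 1).
- by move=> *; apply: has_topM.
exact: topp.
Qed.

(** The cofactor must be c: the difference q - c p is divisible by p, while its
    degree is below k, the degree of p. *)
Lemma has_top_dvdp (F : fieldType) k (c : F) (p q : {poly F}) :
  has_top k 1 p -> has_top k c q -> p %| q -> q = c%:P * p.
Proof.
move=> topp topq pq; apply/eqP; rewrite -subr_eq0; apply: contraT => nz.
have [sz top0] : has_top k (c + (- c) * 1) (q + (- c)%:P * p).
  by apply: has_topD => //; apply: (has_topM (has_topC _) topp).
have pD : p %| q - c%:P * p by rewrite dvdp_sub ?dvdp_mull.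
have kp : (k < size p)%N.
  rewrite ltnNge; apply/negP => /leq_sizeP/(_ _ (leqnn k))/eqP.
  by rewrite topp.2 oner_eq0.
suff szD : (size (q - c%:P * p)%R <= k)%N.
  by have := leq_trans kp (dvdp_leq nz pD); rewrite ltnNge szD.
rewrite polyCN mulNr mulr1 subrr in sz top0.
apply/leq_sizeP => j; rewrite leq_eqVlt => /orP[/eqP <- //|kj].
by move/leq_sizeP: sz; apply.
Qed.

(** Each term of the Leibniz expansion takes one entry from every row, so the
    degree bounds of the rows add up. *)
Lemma has_top_det (R : comNzRingType) (m : nat) (r : 'I_m -> nat)
    (C : 'M[R]_m) (A : 'M[{poly R}]_m) :
  (forall i j, has_top (r i) (C i j) (A i j)) ->
  has_top (\sum_i r i) (\det C) (\det A).
Proof.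
move=> topA; rewrite /determinant.
apply: (big_ind2 (fun c p => has_top (\sum_i r i) c p)) => [|c p c' q|s _].
- by split; rewrite ?size_poly0 ?coef0.
- exact: has_topD.
rewrite -[(\sum_i r i)%N]add0n; apply: has_topM.
  rewrite -(rmorph_sign (polyC : {rmorphism R -> {poly R}})).
  exact: has_topC.
by apply: has_top_prod => i; apply: topA.
Qed.

(** * Divisibility of a determinant by column differences *)

(** Here r pairs some columns j with a partner j' which has itself no partner.
    Subtracting from every such column its partner makes it divisible by p, so
    the new matrix is a product B D with D diagonal.  The partners themselves
    are unchanged, so right multiplication by 1 + N adds them back:
    A = B D (1 + N), and det D is the required power of p. *)
Lemma dvdp_det_columns (F : fieldType) (m : nat) (A : 'M[{poly F}]_m)
    (p : {poly F}) (r : rel 'I_m) :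
  (forall j j' j'', r j j' -> ~~ r j' j'') ->
  (forall i j j', r j j' -> p %| A i j - A i j') ->
  p ^+ #|[set j | [exists j', r j j']]| %| \det A.
Proof.
move=> r2 rp; pose J := [set j | [exists j', r j j']].
pose g j := odflt j [pick j' | r j j'].
have rg j : j \in J -> r j (g j).
  rewrite inE => /existsP[j' rj]; rewrite /g.
  by case: pickP => // /(_ j'); rewrite rj.
have gJ j : j \in J -> g j \notin J.
  by move=> /rg jg; rewrite inE; apply/existsPn => j''; apply: r2 jg.
pose B := \matrix_(i, j) if j \in J then (A i j - A i (g j)) %/ p else A i j.
pose D := diag_mx (\row_j if j \in J then p else 1).
pose N := \matrix_(k, j) ((j \in J) && (k == g j))%:R : 'M[{poly F}]_m.
have BDE i j : (B *m D) i j = if j \in J then A i j - A i (g j) else A i j.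
  rewrite mul_mx_diag !mxE; case: ifP => jJ; last by rewrite mulr1.
  by rewrite divpK // rp // rg.
have -> : A = B *m D *m (1%:M + N).
  apply/matrixP=> i j; rewrite mulmxDr mulmx1 mxE BDE mxE.
  case: (boolP (j \in J)) => jJ; last first.
    by rewrite big1 ?addr0 // => k _; rewrite [N _ _]mxE (negPf jJ) mulr0.
  rewrite (bigD1 (g j)) //= big1 ?addr0 => [|k /negPf kg].
    by rewrite BDE (negPf (gJ j jJ)) [N _ _]mxE jJ eqxx mulr1 subrK.
  by rewrite [N _ _]mxE kg andbF mulr0.
rewrite !det_mulmx det_diag -/J; apply/dvdp_mulr/dvdp_mull.
under eq_bigr do rewrite mxE.
by rewrite -big_mkcond /= prodr_const dvdpp.
Qed.

Lemma dvdp_prod_coprime (F : fieldType) (p : nat -> {poly F}) (q : {poly F}) N :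
  (forall s t, (s < t)%N -> coprimep (p s) (p t)) -> (forall s, p s %| q) ->
  \prod_(0 <= s < N) p s %| q.
Proof.
move=> cop pq; elim: N => [|N IHN]; first by rewrite big_nil dvd1p.
rewrite big_nat_recr //= Gauss_dvdp ?IHN ?pq //.
rewrite big_nat_cond; apply: (big_ind (fun u => coprimep u (p N))).
- exact: coprime1p.
- by move=> u v cu cv; rewrite coprimepMl cu.
by move=> s; rewrite andbT => /andP[_ sN]; apply: cop.
Qed.

(** * The entries of the matrix *)

Lemma has_top_lambda d n (mu nu : npair d) :
  has_top mu.2 (lambda' n mu nu) (lambda n mu nu).
Proof.
rewrite -[X in has_top X]addn0 /lambda /lambda'; apply: has_topM; last first.
  have := has_topX (mu.1 - mu.2) (has_topC ((nu.1 + nu.2)%N%:R : int)).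
  by rewrite mul0n rmorph_nat.
rewrite -[X in has_top X]mul1n; apply: has_topX.
set l := ell n nu.
have -> : (2%:R * 'X + 1) * l%:R - l%:R ^+ 2
    = (2%:R * l%:R)%:P * 'X + (l%:R - l%:R ^+ 2)%:P :> {poly int}.
  by rewrite rmorphM rmorphB rmorphXn !rmorph_nat; ring.
rewrite -[X in has_top _ X]addr0; apply: has_topD; last first.
  by split; rewrite ?coefC // (leq_trans (size_polyC_leq1 _)).
rewrite -[X in has_top _ X]mulr1; apply: (@has_topM _ 0 1).
  exact: has_topC.
by split; rewrite ?size_polyX ?coefX.
Qed.

(** At x = (l + l' - 1)/2 one has y(l) = l l', which is symmetric in l and l':
    this is why columns of equal weight with these l and l' agree there. *)
Lemma lambda_horner_half d n (mu nu : npair d) (l' : nat) :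
  (0 < ell n nu + l')%N ->
  (map_poly (intr : int -> rat) (lambda n mu nu)).[
    (ell n nu + l' - 1)%:R / 2%:R]
  = (ell n nu * l')%:R ^+ mu.2 * (weight nu)%:R ^+ (mu.1 - mu.2).
Proof.
move=> ell_gt0; rewrite /lambda -/(weight nu) -horner_evalE.
rewrite !(rmorphM, rmorphXn, rmorphB, rmorphD, rmorph_nat, rmorph1) /=.
rewrite map_polyX horner_evalE hornerX natrB; last by lia.
by congr (_ ^+ _ * _); rewrite natrD; field.
Qed.

(** * Counting pairs of equal weight *)

(** Exchanging the two members of a pair shows that a tournament r on the edges
    of E has as many arcs as its reverse; the common number does not depend on
    r, which allows one tournament to be replaced by another. *)
Lemma card_tournament (T : finType) (E r : rel T) :
  symmetric E ->
  (forall a b, E a b -> (r a b + r b a = (a != b))%N) ->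
  (#|[set p | E p.1 p.2 && r p.1 p.2]|.*2
    = #|[set p | E p.1 p.2 && (p.1 != p.2)]|)%N.
Proof.
move=> Esym rE; rewrite !cardsE -!sum1_card /= -addnn.
have swap_inj : injective (fun p : T * T => (p.2, p.1)).
  by move=> [a b] [a' b'] [-> ->].
rewrite [X in (_ + X)%N](reindex_inj swap_inj).
rewrite big_mkcond [X in (_ + X)%N]big_mkcond -big_split /=.
rewrite [RHS]big_mkcond; apply: eq_bigr => -[a b] _ /=.
rewrite !unfold_in /= [E b a]Esym.
by have := rE a b; case: (E a b) => [/(_ isT)|_] //=.
Qed.

Lemma ell_le d n (nu : npair d) : (ell n nu <= n)%N.
Proof. by rewrite /ell; lia. Qed.

(** At fixed weight the parity of m = nu_1 - nu_2 is fixed, and m and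
    2n + 1 - m have opposite parities, so the minimum of the two determines
    m. *)
Lemma ell_inj d n (nu nu' : npair d) :
  nu \in LambdaStar d n -> nu' \in LambdaStar d n ->
  weight nu = weight nu' -> ell n nu = ell n nu' -> nu = nu'.
Proof.
case: nu nu' => a b [a' b']; rewrite !inE /in_P /weight /ell /=.
by move=> H H' ew el; congr (_, _); apply: val_inj => /=; lia.
Qed.

Definition same_weight d n : rel (npair d) := fun nu nu' =>
  [&& nu \in LambdaStar d n, nu' \in LambdaStar d n & weight nu == weight nu'].

(** The range of s is exhaustive because l_nu' < l_nu <= n forces
    l_nu + l_nu' - 1 <= 2n - 2. *)
Lemma sum_f d n :
  (\sum_(0 <= s < (2 * n - 2).+1) f n d s
   = #|[set p : npair d * npair d |
         same_weight n p.1 p.2 && (ell n p.2 < ell n p.1)]|)%N.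
Proof.
rewrite big_mkord -sum1_card.
rewrite (partition_big
  (fun p : npair d * npair d =>
     inord (ell n p.1 + ell n p.2 - 1) : 'I_(2 * n - 2).+1) predT) //=.
apply: eq_bigr => s _; rewrite /f -sum1_card; apply: eq_bigl => -[nu nu'].
rewrite in_set in_setX /= [in RHS]in_set /same_weight /= -!andbA.
do 3!apply: andb_id2l => _; apply: andb_id2l => lt_ell.
by rewrite -[inord _ == _]val_eqE /= inordK //; have := ell_le n nu; lia.
Qed.

(** With w = |nu|, every second coordinate from nu_2 + 1 to floor(w/2) occurs
    exactly once in Lambda* at weight w: the lower bound that defines Lambda* is
    inherited from nu. *)
Lemma card_second_gt d n (nu : npair d) : nu \in LambdaStar d n ->
  (#|[set nu' | same_weight n nu nu' && (nu.2 < nu'.2)]|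
   = (weight nu)./2 - nu.2)%N.
Proof.
move=> nuS; pose k := ((weight nu)./2 - nu.2)%N.
pose h (i : 'I_k) : npair d :=
  (inord (weight nu - (nu.2 + i.+1)), inord (nu.2 + i.+1)).
have wd : (weight nu <= d)%N by move: nuS; rewrite inE => /and3P[].
have hE (i : 'I_k) : (h i).1 = (weight nu - (nu.2 + i.+1))%N :> nat
    /\ (h i).2 = (nu.2 + i.+1)%N :> nat.
  by rewrite !inordK //; have := ltn_ord i; rewrite /k; lia.
rewrite -[RHS](card_ord k) -(@card_imset _ _ h) => [|i j hij]; last first.
  by apply: val_inj; have [_] := hE i; rewrite hij (hE j).2 /=; lia.
apply: eq_card => -[a' b']; rewrite inE /same_weight nuS /=.
apply/idP/imsetP => [/andP[/andP[nu'S /eqP ew] lt2]|[i _]].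
  move: nu'S; rewrite inE /in_P /weight /= => /and3P[le12 _ _].
  have lt_k : (b' - nu.2 - 1 < k)%N by rewrite /k ew /weight /=; lia.
  exists (Ordinal lt_k) => //; have [] := hE (Ordinal lt_k).
  case: (h _) => a b /=; rewrite ew /weight /= => ea eb.
  by congr (_, _); apply: val_inj => /=; lia.
have [] := hE i; case: (h i) => a b /= ea eb [-> ->]; have := ltn_ord i.
by move: nuS wd ea eb; rewrite /k !inE /in_P /weight /=; lia.
Qed.

(** The weight-preserving involution exchanging Lambda and Lambda* turns mu_2
    into floor(|nu|/2) - nu_2. *)
Lemma sum_second_Lambda d n :
  (\sum_(mu in Lambda d n) mu.2
   = \sum_(nu in LambdaStar d n) ((weight nu)./2 - nu.2))%N.
Proof.
have dual_im : LambdaStar d n = [set npair_dual mu | mu in Lambda d n].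
  apply/setP => nu; apply/idP/imsetP.
    rewrite inE => /and3P[h1 h2 h3].
    exists (npair_dual nu); last by rewrite npair_dualK.
    have [h1' ew] := npair_dual_P h1 h2; rewrite inE h1' ew h2.
    by have [_ ->] := npair_dualE h1 h2; move: h3; rewrite /=; lia.
  move=> [mu + ->]; rewrite inE => /and3P[h1 h2 h3].
  have [h1' ew] := npair_dual_P h1 h2; rewrite inE h1' ew h2.
  by have [_ ->] := npair_dualE h1 h2; move: h3; rewrite /=; lia.
rewrite dual_im big_imset /= => [|mu mu']; last first.
  rewrite !inE => /and3P[h1 h2 _] /and3P[h1' h2' _] e.
  by rewrite -(npair_dualK h1 h2) e npair_dualK.
apply: eq_bigr => mu; rewrite inE => /and3P[h1 h2 _].
have [_ ew] := npair_dual_P h1 h2; rewrite ew.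
have [_ ->] := npair_dualE h1 h2; move: h1 h2; rewrite /in_P /weight; lia.
Qed.

(** Both l and nu_2 separate the elements of Lambda* of a given weight, so they
    define two tournaments on the same edges. *)
Lemma sum_f_second d n :
  (\sum_(0 <= s < (2 * n - 2).+1) f n d s = \sum_(mu in Lambda d n) mu.2)%N.
Proof.
have wsym : symmetric (@same_weight d n).
  by move=> a b; rewrite /same_weight eq_sym andbCA.
apply: double_inj; rewrite sum_f.
rewrite (card_tournament (r := fun a b => ell n b < ell n a)%N) //.
  rewrite -(card_tournament (r := fun a b : npair d => a.2 < b.2)%N) //.
    congr _.*2; rewrite sum_second_Lambda -sum1_card.
    rewrite (eq_bigl (fun p : npair d * npair d => (p.1 \in LambdaStar d n) &&
       (p.2 \in [set nu' | same_weight n p.1 nu' && (p.1.2 < nu'.2)%N]))).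
      rewrite -(pair_big_dep (fun nu => nu \in LambdaStar d n)
        (fun nu nu' => nu' \in
           [set nu' | same_weight n nu nu' && (nu.2 < nu'.2)%N])
        (fun _ _ => 1%N)) /=.
      by apply: eq_bigr => nu nuS; rewrite sum1_card card_second_gt.
    move=> [nu nu']; rewrite in_set /same_weight /=; case: (nu \in _) => //=.
    by rewrite [RHS]in_set.
  move=> a b /and3P[aS bS /eqP ew]; rewrite [a == b]/eq_op /= -!val_eqE /=.
  by move: aS bS ew; rewrite !inE /in_P /weight; lia.
move=> a b /and3P[aS bS /eqP ew]; have := ell_inj aS bS ew.
case: ltngtP => // [|| e ->] //; rewrite ?eqxx //; case: eqVneq => // ->; lia.
Qed.

(** * The determinant *)

(** The pairs counted by f(d,s), transported to column indices, satisfy the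
    hypotheses of [dvdp_det_columns]. *)
Lemma dvdp_det_M d n s :
  ('X - (s%:R / 2%:R)%:P) ^+ f n d s
    %| \det (map_mx (map_poly (intr : int -> rat)) (M d n)).
Proof.
pose c := tnth (col_index d n).
pose S := [set p in setX (LambdaStar d n) (LambdaStar d n) |
      [&& weight p.1 == weight p.2, (ell n p.2 < ell n p.1)%N &
          ell n p.1 + ell n p.2 - 1 == s]%N].
pose r j j' := (c j, c j') \in S.
have SP nu nu' : (nu, nu') \in S ->
    [/\ nu \in LambdaStar d n, nu' \in LambdaStar d n, weight nu = weight nu',
        (ell n nu' < ell n nu)%N & (ell n nu + ell n nu' - 1 = s)%N].
  by rewrite in_set in_setX /= => /andP[/andP[? ?] /and3P[/eqP ? ? /eqP ?]].
(* A pair is determined by its first member, so there are at most as many pairs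
   as columns having a partner. *)
have fJ : (f n d s <= #|[set j | [exists j', r j j']]|)%N.
  rewrite /f -/S -(@card_in_imset _ _ fst) => [|[a b] [a' b']]; last first.
    move=> /SP[_ bS w lt e] /SP[_ b'S w' lt' e'] /= aa'.
    case: a' / aa' w' lt' e' => w' lt' e'.
    by rewrite -(ell_inj bS b'S) -?w //; lia.
  apply: leq_trans (leq_imset_card c _); apply/subset_leq_card/subsetP => nu0.
  have cS nu : nu \in LambdaStar d n -> exists j, nu = c j.
    by move=> nuS; apply/tnthP; rewrite mem_sort mem_enum.
  case/imsetP=> -[nu nu'] p -> /=; have [nuS nu'S _ _ _] := SP _ _ p.
  have [[j ej] [j' ej']] := (cS _ nuS, cS _ nu'S).
  apply/imsetP; exists j; rewrite // inE; apply/existsP; exists j'.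
  by rewrite /r -ej -ej'.
apply: dvdp_trans (dvdp_exp2l _ fJ) _; apply: dvdp_det_columns.
  move=> j j' j'' /SP[_ _ _ lt e]; apply/negP => /SP[_ _ _ lt' e']; lia.
move=> i j j' /SP[_ _ w lt e]; rewrite dvdp_XsubCl rootE hornerD hornerN !mxE.
rewrite -/(c j) -/(c j') -e lambda_horner_half; last by lia.
by rewrite addnC lambda_horner_half 1?mulnC ?w ?subrr //; lia.
Qed.

Theorem theorem4p7 (n d : nat) (hn : (1 <= n)%N) :
  map_poly (intr : int -> rat) (\det (M d n)) =
  ((\det (M' d n))%:~R : rat)%:P *
    \prod_(0 <= s < (2 * n - 2).+1) ('X - (s%:R / 2%:R)%:P) ^+ f n d s.
Proof.
have sum_rows : (\sum_i (tnth (row_index d n) i).2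
    = \sum_(0 <= s < (2 * n - 2).+1) f n d s)%N.
  rewrite sum_f_second.
  rewrite -(big_tuple _ _ (row_index d n) xpredT (fun mu => mu.2 : nat)).
  by rewrite (perm_big _ (permEl (perm_sort _ _))) big_enum.
have [sz_det top_det] :
    has_top (\sum_(0 <= s < (2 * n - 2).+1) f n d s)
      (\det (M' d n)) (\det (M d n)).
  rewrite -sum_rows; apply: has_top_det => i j; rewrite !mxE.
  exact: has_top_lambda.
apply: (has_top_dvdp (k := \sum_(0 <= s < (2 * n - 2).+1) f n d s)).
- have := has_top_prod (index_iota 0 (2 * n - 2).+1)
    (fun s => has_topX (f n d s) (has_top_XsubC (s%:R / 2%:R : rat))).
  rewrite [X in has_top _ X]big1 => [|s _]; last exact: expr1n.
  by rewrite (eq_bigr (f n d) (fun s _ => mul1n _)).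
- split; last by rewrite coef_map top_det.
  by apply: leq_trans (size_poly _ _) sz_det.
apply: dvdp_prod_coprime => [s t lt_st|s].
  rewrite coprimep_expl // coprimep_expr // coprimep_XsubC root_XsubC.
  by rewrite (inj_eq (mulIf _)) // Num.Theory.eqr_nat neq_ltn lt_st ?orbT.
by rewrite -det_map_mx; apply: dvdp_det_M.
Qed.
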